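(* Let $$\widetilde G=\begin{bmatrix}g_1^{11} & J_1^{-1}P_{1c}\hat J\hat g^{12}P_{c2}\\ J_2^{-1}P_{2c}\hat J\hat g^{12}P_{c1} & g_2^{22}\end{bmatrix},\qquad H=\begin{bmatrix}H_1&0\\0&H_2\end{bmatrix},\qquad J=\begin{bmatrix}J_1&0\\0&J_2\end{bmatrix}.$$ Assume that the null-spaces of $P_{c1}$ and $P_{c2}$ are trivial. Let $\max\lambda^{(1)}$ and $\max\lambda^{(2)}$ be the largest eigenvalues of the generalized eigenvalue problems $$P_{c1}^T\hat H\hat J\hat g^{11}P_{c1}\boldsymbol{y}=\lambda^{(1)}H_1J_1g_1^{11}\boldsymbol{y},\qquad P_{c2}^T\hat H\hat J\hat g^{22}P_{c2}\boldsymbol{y}=\lambda^{(2)}H_2J_2g_2^{22}\boldsymbol{y},$$ and let $0<\alpha\le 1/\max\lambda^{(1)}$ and $0<\beta\le 1/\max\lambda^{(2)}$. Consider $$C(\alpha,\beta)=\begin{bmatrix}\alpha\hat H\hat J\hat g^{11}&\hat H\hat J\hat g^{12}\\ \hat H\hat J\hat g^{12}&\beta\hat H\hat J\hat g^{22}\end{bmatrix},$$ whose four blocks are diagonal, so that it decouples into one symmetric $2\times2$ matrix per cell-centered grid point. If this $2\times2$ matrix is positive definite at every cell-centered grid point, then $HJ\widetilde G$ is positive definite.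
   Context: Let $N\ge1$ be an integer, $\hat N=(N+2)(N+2)$, $N_1=(N+1)(N+2)$, $N_2=(N+2)(N+1)$, and let $\hat I$ be the $(N+2)\times(N+2)$ identity matrix. $M\in\mathbb{R}^{(N+1)\times(N+1)}$ and $\hat M\in\mathbb{R}^{(N+2)\times(N+2)}$ are positive definite diagonal matrices, and $P\in\mathbb{R}^{(N+1)\times(N+2)}$, $\hat P\in\mathbb{R}^{(N+2)\times(N+1)}$ are staggered SBP interpolation operators: $MP=\hat P^T\hat M$. Set $$H_1=M\otimes\hat M,\quad H_2=\hat M\otimes M,\quad \hat H=\hat M\otimes\hat M,$$ $$P_{1c}=P\otimes\hat I\in\mathbb{R}^{N_1\times\hat N},\quad P_{c1}=\hat P\otimes\hat I\in\mathbb{R}^{\hat N\times N_1},\quad P_{2c}=\hat I\otimes P\in\mathbb{R}^{N_2\times\hat N},\quad P_{c2}=\hat I\otimes\hat P\in\mathbb{R}^{\hat N\times N_2}.$$ They satisfy $H_1P_{1c}=P_{c1}^T\hat H$ and $H_2P_{2c}=P_{c2}^T\hat H$. $J_1,g_1^{11}\in\mathbb{R}^{N_1\times N_1}$, $J_2,g_2^{22}\in\mathbb{R}^{N_2\times N_2}$ and $\hat J,\hat g^{11},\hat g^{22}\in\mathbb{R}^{\hat N\times\hat N}$ are diagonal matrices with positive diagonal entries, and $\hat g^{12}\in\mathbb{R}^{\hat N\times\hat N}$ is a real diagonal matrix: these are the Jacobian of the curvilinear mapping and the components of the (symmetric positive definite) contravariant metric tensor, evaluated on the edge-1 grid (subscript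 1), the edge-2 grid (subscript 2), and the cell-centered grid (hat), respectively. *)

(* Defs.v *)
From mathcomp Require Import all_boot all_order all_algebra.
From mathcomp Require Import reals.
From mathcomp Require Export mxtens.

Set Implicit Arguments.
Unset Strict Implicit.
Unset Printing Implicit Defensive.

Import Order.TTheory GRing.Theory Num.Theory.
Local Open Scope ring_scope.

(* Symmetry is part of positive definiteness here. *)
Definition posdefmx (R : realType) (n : nat) (A : 'M[R]_n) : Prop :=
  A^T = A /\ forall x : 'cV[R]_n, x != 0 -> 0 < (x^T *m A *m x) 0 0.

Definition posdiagmx (R : realType) (n : nat) (D : 'M[R]_n) : Prop :=
  is_diag_mx D /\ forall i : 'I_n, 0 < D i i.

Definition trivial_nullspace (R : realType) (m n : nat) (A : 'M[R]_(m, n)) :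
    Prop :=
  forall y : 'cV[R]_n, A *m y = 0 -> y = 0.

Definition gen_eigenvalue (R : realType) (n : nat) (A B : 'M[R]_n) (l : R) :
    Prop :=
  exists2 y : 'cV[R]_n, y != 0 & A *m y = l *: (B *m y).

(* Only real eigenvalues are compared; for A symmetric and B symmetric positive
   definite, every eigenvalue of the pencil is real. *)
Definition max_gen_eigenvalue (R : realType) (n : nat) (A B : 'M[R]_n)
    (l : R) : Prop :=
  gen_eigenvalue A B l /\ forall mu : R, gen_eigenvalue A B mu -> mu <= l.

(* The four entries (k, k) of the n x n blocks of C, as a 2 x 2 matrix. *)
Definition point_block (R : realType) (n : nat) (C : 'M[R]_(n + n))
    (k : 'I_n) : 'M[R]_2 :=
  let idx (i : 'I_2) := if i == 0 then lshift n k else rshift n k in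
  mxsub idx idx C.

(* Main.v *)
Require Import Defs.
From mathcomp Require Import all_boot all_order all_algebra.
From mathcomp Require Import classical_sets reals.
From mathcomp Require Import ring lra.

Set Implicit Arguments.
Unset Strict Implicit.
Unset Printing Implicit Defensive.

Import Order.TTheory GRing.Theory Num.Theory.
Local Open Scope ring_scope.

(* The coupling blocks of H J G are the congruences Pc1^T (Hh Jh gh12) Pc2 and
   its transpose, so the quadratic form of H J G at (u, v) dominates the form of
   C(alpha, beta) at (Pc1 u, Pc2 v), once the congruence of each diagonal block
   of C is bounded by the corresponding diagonal block of H J G.  That bound is
   the extremality of the largest generalized eigenvalue.  It is obtained
   without the spectral theorem: if s is the supremum of the Rayleigh quotient
   of (A, B), then s B - A is positive semidefinite; were it invertible, it
   would dominate a positive multiple of B, contradicting the choice of s.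
   Hence s is an eigenvalue. *)

(** * Bilinear forms of matrices *)

(** The two vectors may differ in length, so the rectangular coupling blocks are covered as well. *)
Definition bform (R : realType) (m n : nat) (A : 'M[R]_(m, n))
    (x : 'cV[R]_m) (y : 'cV[R]_n) : R :=
  (x^T *m A *m y) 0 0.

Lemma bform_sum (R : realType) (m n : nat) (A : 'M[R]_(m, n)) x y :
  bform A x y = \sum_i \sum_j x i 0 * A i j * y j 0.
Proof.
rewrite /bform mxE exchange_big; apply: eq_bigr => j _ /=.
by rewrite mxE mulr_suml; apply: eq_bigr => i _; rewrite !mxE.
Qed.

Lemma bform_diag (R : realType) (n : nat) (D : 'M[R]_n) x y :
  is_diag_mx D -> bform D x y = \sum_i x i 0 * D i i * y i 0.
Proof.
move=> /is_diag_mxP hD; rewrite bform_sum; apply: eq_bigr => i _.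
rewrite (bigD1 i) //= big1 ?addr0 // => j ji.
by rewrite hD ?mulr0 ?mul0r // eq_sym.
Qed.

Lemma bform_trmx (R : realType) (m n : nat) (A : 'M[R]_(m, n)) x y :
  bform A^T y x = bform A x y.
Proof.
rewrite /bform -[in RHS](trmxK (x^T *m A *m y)) [in RHS]mxE.
by rewrite !trmx_mul trmxK mulmxA.
Qed.

Lemma bform_congr (R : realType) (m n p q : nat) (A : 'M[R]_(m, n))
    (S : 'M[R]_(m, p)) (T : 'M[R]_(n, q)) x y :
  bform (S^T *m A *m T) x y = bform A (S *m x) (T *m y).
Proof. by rewrite /bform trmx_mul !mulmxA. Qed.

Lemma bform_block (R : realType) (m n : nat) (A : 'M[R]_m) (B : 'M[R]_(m, n))
    (C : 'M[R]_(n, m)) (D : 'M[R]_n) u v :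
  bform (block_mx A B C D) (col_mx u v) (col_mx u v) =
  bform A u u + bform B u v + bform C v u + bform D v v.
Proof.
rewrite /bform tr_col_mx -mulmxA mul_block_col mul_row_col !mulmxDr.
by rewrite !mulmxA !mxE !addrA.
Qed.

Lemma bformBl (R : realType) (m n : nat) (A B : 'M[R]_(m, n)) x y :
  bform (A - B) x y = bform A x y - bform B x y.
Proof. by rewrite /bform mulmxBr mulmxBl !mxE. Qed.

Lemma bformZl (R : realType) (m n : nat) (a : R) (A : 'M[R]_(m, n)) x y :
  bform (a *: A) x y = a * bform A x y.
Proof. by rewrite /bform -scalemxAr -scalemxAl mxE. Qed.

Lemma bform_combine (R : realType) (n : nat) (A : 'M[R]_n) x y s t :
  A^T = A ->
  bform A (s *: x + t *: y) (s *: x + t *: y) =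
  s ^+ 2 * bform A x x + 2 * s * t * bform A x y + t ^+ 2 * bform A y y.
Proof.
move=> sA; have h : bform A y x = bform A x y by rewrite -{1}sA bform_trmx.
have E : bform A (s *: x + t *: y) (s *: x + t *: y) =
    s ^+ 2 * bform A x x + s * t * bform A x y + s * t * bform A y x
    + t ^+ 2 * bform A y y.
  rewrite /bform [(_ + _)^T]linearD /= ![(_ *: _)^T]linearZ /= !mulmxDl !mulmxDr.
  by rewrite -!scalemxAl -!scalemxAr !mxE; ring.
by rewrite E h; ring.
Qed.

(** * Positive semidefinite matrices and domination of quadratic forms *)

Definition psdmx (R : realType) (n : nat) (A : 'M[R]_n) : Prop :=
  A^T = A /\ forall x : 'cV[R]_n, 0 <= bform A x x.

Lemma posdef_psd (R : realType) (n : nat) (A : 'M[R]_n) :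
  posdefmx A -> psdmx A.
Proof.
move=> [sA pA]; split=> // x; have [->|/pA/ltW//] := eqVneq x 0.
by rewrite /bform mulmx0 mxE.
Qed.

Lemma psd_cauchy_schwarz (R : realType) (n : nat) (A : 'M[R]_n) x y :
  psdmx A -> bform A x y ^+ 2 <= bform A x x * bform A y y.
Proof.
move=> [sA pA]; have F s t := pA (s *: x + t *: y).
have {}F s t : 0 <= s ^+ 2 * bform A x x + 2 * s * t * bform A x y
                 + t ^+ 2 * bform A y y by rewrite -bform_combine.
move: (pA x) (pA y) F; set a := bform A x x; set b := bform A x y.
set c := bform A y y => a0 c0 F.
have [c_gt0|] := ltrP 0 c.
  (* The pair [(c, - b)] minimises the form along a line; its value is [c] times the gap
     [a * c - b ^+ 2]. *)
  have := F c (- b).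
  have -> : c ^+ 2 * a + 2 * c * - b * b + (- b) ^+ 2 * c = c * (a * c - b ^+ 2)
    by ring.
  by rewrite pmulr_rge0 // subr_ge0.
move=> c_le0; have -> : c = 0 by lra.
(* With [c = 0] the form at this pair equals [- 4 * b ^+ 2], so its nonnegativity forces [b = 0]. *)
have := F (2 * b) (- (a + 1)).
have -> : c = 0 by lra.
by nra.
Qed.

(** [det0P] yields a left null vector, which symmetry turns into a right one. *)
Lemma unitmx_kernel (R : realType) (n : nat) (A : 'M[R]_n) :
  A^T = A -> A \notin unitmx -> exists2 y : 'cV[R]_n, y != 0 & A *m y = 0.
Proof.
move=> sA; rewrite unitmxE unitfE negbK => /det0P [v v0 vA].
by exists v^T; [rewrite trmx_eq0 | rewrite -{1}sA -trmx_mul vA trmx0].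
Qed.

Lemma posdef_unitmx (R : realType) (n : nat) (A : 'M[R]_n) :
  posdefmx A -> A \in unitmx.
Proof.
move=> [sA pA]; apply/negPn/negP => /(unitmx_kernel sA) [y /pA + Ay].
by rewrite -mulmxA Ay mulmx0 mxE ltxx.
Qed.

(* Cauchy-Schwarz with [y = A^-1 e_i] bounds each squared coordinate of [x]. *)
Lemma psd_coord_bound (R : realType) (n : nat) (A : 'M[R]_n) :
  psdmx A -> A \in unitmx -> exists2 w : 'I_n -> R, (forall i, 0 <= w i) &
  forall (x : 'cV[R]_n) i, x i 0 ^+ 2 <= w i * bform A x x.
Proof.
move=> psdA uA; pose e i : 'cV[R]_n := invmx A *m delta_mx i 0.
exists (fun i => bform A (e i) (e i)) => [i|x i]; first exact: psdA.2.
have := psd_cauchy_schwarz x (e i) psdA.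
suff -> : bform A x (e i) = x i 0 by rewrite mulrC.
by rewrite /bform /e -mulmxA mulKVmx // -colE !mxE.
Qed.

(** Each term of the form of [K] is controlled by [x_i ^+ 2 + x_j ^+ 2], hence by the coordinate
    bounds [w i] and [w j]. No symmetry of [K] enters. *)
Lemma psd_dominates (R : realType) (n : nat) (A K : 'M[R]_n) :
  psdmx A -> A \in unitmx ->
  exists2 c : R, 0 < c & forall x, bform K x x <= c * bform A x x.
Proof.
move=> psdA uA; have [w w0 hw] := psd_coord_bound psdA uA.
have term0 i j : 0 <= `|K i j| * (w i + w j) by rewrite mulr_ge0 ?addr_ge0.
(* The summand 1 keeps the constant positive even when [K = 0]. *)
exists (1 + \sum_i \sum_j `|K i j| * (w i + w j)).
  by rewrite ltr_pwDl // sumr_ge0 // => i _; rewrite sumr_ge0.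
move=> x; rewrite mulrDl mul1r -[leLHS]add0r lerD ?psdA.2 //.
rewrite bform_sum mulr_suml; apply: ler_sum => i _.
rewrite mulr_suml; apply: ler_sum => j _.
apply: (le_trans (ler_norm _)).
rewrite mulrAC normrM mulrC -mulrA ler_wpM2l // mulrDl.
apply: le_trans (lerD (hw x i) (hw x j)).
by rewrite ler_norml; nra.
Qed.

(** * The largest generalized eigenvalue bounds the Rayleigh quotient *)

Lemma rayleigh_le_max_gen_eigenvalue (R : realType) (n : nat)
    (A B : 'M[R]_n) (l : R) :
  A^T = A -> posdefmx B -> max_gen_eigenvalue A B l ->
  forall x, bform A x x <= l * bform B x x.
Proof.
move=> sA pdB [[y0 y0_neq0 _] lmax].
have psdB := posdef_psd pdB.
(* Domination of [A] by [c *: B] bounds the Rayleigh quotients above; the eigenvector [y0] shows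
   that there is at least one. *)
have [c _ hc] := psd_dominates A psdB (posdef_unitmx pdB).
pose E := [set r : R | exists2 x : 'cV[R]_n, x != 0 &
             r = bform A x x / bform B x x]%classic.
have E0 : (E !=set0)%classic by exists (bform A y0 y0 / bform B y0 y0), y0.
have quotE x t : x != 0 ->
    (bform A x x / bform B x x <= t) = (bform A x x <= t * bform B x x).
  by move=> /pdB.2 Bx; rewrite ler_pdivrMr.
have Eub : has_ubound E by exists c => r [x x0 ->]; rewrite quotE.
have sB_psd : psdmx (sup E *: B - A).
  split=> [|x]; first by rewrite linearB linearZ /= sA pdB.1.
  rewrite bformBl bformZl subr_ge0.
  have [->|x0] := eqVneq x 0; first by rewrite /bform !mulmx0 mxE mulr0.
  by rewrite -quotE //; apply: ub_le_sup => //; exists x.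
have sB_sing : sup E *: B - A \notin unitmx.
  (* If [B] is dominated by [d] times [sup E *: B - A], then every quotient is at most
     [sup E - d^-1], strictly below the supremum. *)
  apply/negP => /(psd_dominates B sB_psd) [d d0 hd].
  have : sup E <= sup E - d^-1.
    apply: ge_sup => // r [x x0 ->]; rewrite quotE // mulrBl lerBrDr.
    rewrite -lerBrDl -(ler_pM2l d0) mulrA divff ?gt_eqF // mul1r.
    by have := hd x; rewrite bformBl bformZl.
  by rewrite lerBrDr gerDl invr_le0 leNgt d0.
(* A null vector [y] satisfies [A y = sup E * B y], so the maximality of [l] applies to [sup E]. *)
have [y y_neq0 hy] := unitmx_kernel sB_psd.1 sB_sing.
have sl : sup E <= l.
  apply: lmax; exists y => //; apply/eqP.
  by rewrite eq_sym -subr_eq0 scalemxAl -mulmxBl hy.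
move=> x; have := sB_psd.2 x; rewrite bformBl bformZl subr_ge0 => /le_trans.
by apply; rewrite ler_wpM2r // psdB.2.
Qed.

Lemma scaled_rayleigh_bound (R : realType) (n : nat)
    (A B : 'M[R]_n) (l a : R) :
  A^T = A -> posdefmx B -> max_gen_eigenvalue A B l -> 0 < a <= 1 / l ->
  forall x, a * bform A x x <= bform B x x.
Proof.
move=> sA pdB hl /andP[a0 al] x.
(* A positive lower bound on [1 / l] also excludes [l = 0], because the inverse of 0 is 0. *)
have l0 : 0 < l by rewrite -invr_gt0 -div1r (lt_le_trans a0).
have := rayleigh_le_max_gen_eigenvalue sA pdB hl x.
rewrite -(ler_pM2l a0) => /le_trans; apply; rewrite mulrA -[leRHS]mul1r.
rewrite ler_wpM2r ?(posdef_psd pdB).2 //.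
by move: al; rewrite ler_pdivlMr.
Qed.

(** * Diagonal matrices *)

Lemma diag_trmx (R : realType) (n : nat) (D : 'M[R]_n) :
  is_diag_mx D -> D^T = D.
Proof. by move=> /diag_mxP [d ->]; rewrite tr_diag_mx. Qed.

Lemma is_diag_mulmx (R : realType) (n : nat) (D E : 'M[R]_n) :
  is_diag_mx D -> is_diag_mx E -> is_diag_mx (D *m E).
Proof.
move=> /diag_mxP [d ->] /diag_mxP [e ->].
by rewrite mulmx_diag diag_mx_is_diag.
Qed.

Lemma posdiag_mulmx (R : realType) (n : nat) (D E : 'M[R]_n) :
  posdiagmx D -> posdiagmx E -> posdiagmx (D *m E).
Proof.
move=> [dD pD] [dE pE]; split=> [|i]; first exact: is_diag_mulmx.
move: pD pE; have /diag_mxP [d ->] := dD; have /diag_mxP [e ->] := dE.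
move=> /(_ i) + /(_ i).
by rewrite mulmx_diag !mxE eqxx !mulr1n; exact: mulr_gt0.
Qed.

Lemma posdiag_tensmx (R : realType) (m n : nat) (D : 'M[R]_m) (E : 'M[R]_n) :
  posdiagmx D -> posdiagmx E -> posdiagmx (D *t E).
Proof.
move=> [/is_diag_mxP dD pD] [/is_diag_mxP dE pE]; split=> [|k]; last first.
  by case: (mxtens_indexP k) => i j; rewrite tensmxE mulr_gt0.
apply/is_diag_mxP => k l; case: (mxtens_indexP k) => i j.
case: (mxtens_indexP l) => i' j' neq; rewrite tensmxE.
have [ii'|ii'] := eqVneq i i'; last by rewrite dD ?mul0r.
have [jj'|jj'] := eqVneq j j'; last by rewrite dE ?mulr0.
by rewrite ii' jj' eqxx in neq.
Qed.

Lemma posdef_posdiag (R : realType) (n : nat) (D : 'M[R]_n) :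
  is_diag_mx D -> posdefmx D -> posdiagmx D.
Proof.
move=> dD [_ pD]; split=> // i.
have := pD (delta_mx i 0); rewrite trmx_delta -mulmxA -colE -rowE !mxE; apply.
by apply/eqP => /matrixP/(_ i 0)/eqP; rewrite !mxE !eqxx oner_eq0.
Qed.

Lemma posdiag_posdef (R : realType) (n : nat) (D : 'M[R]_n) :
  posdiagmx D -> posdefmx D.
Proof.
move=> [dD pD]; split=> [|x x0]; first exact: diag_trmx.
rewrite -/(bform D x x) bform_diag //.
have term0 i : 0 <= x i 0 * D i i * x i 0.
  by rewrite mulrAC mulr_ge0 ?sqr_ge0 // ltW.
rewrite lt_def sumr_ge0 // andbT; apply: contra_neq x0 => /eqP.
rewrite psumr_eq0 // => /allP x0; apply/matrixP => i j.
rewrite ord1 mxE; apply/eqP; have /= := x0 i (mem_index_enum i).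
by rewrite mulrAC !mulf_eq0 (gt_eqF (pD i)) orbF orbb.
Qed.

Lemma posdiag_unitmx (R : realType) (n : nat) (D : 'M[R]_n) :
  posdiagmx D -> D \in unitmx.
Proof. by move/posdiag_posdef/posdef_unitmx. Qed.

(** * From pointwise 2 x 2 blocks to the full block form *)

Lemma point_block_form (R : realType) (n : nat) (A B C : 'M[R]_n) (k : 'I_n) :
  posdefmx (point_block (block_mx A B B C) k) ->
  forall a b : R, (a != 0) || (b != 0) ->
  0 < a * A k k * a + 2 * (a * B k k * b) + b * C k k * b.
Proof.
move=> [_ pd] a b ab.
pose x : 'cV[R]_2 := \col_i if i == 0 then a else b.
have x0 : x != 0.
  apply: contraTneq ab => /matrixP x0.
  have := x0 0 0; have := x0 1 0; rewrite !mxE /= => -> ->.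
  by rewrite eqxx.
have := pd x x0; rewrite -/(bform _ x x) bform_sum !big_ord_recl !big_ord0.
(* [unsplitK] decides in which half [lshift n k] and [rshift n k] fall, which selects the block. *)
rewrite /point_block !mxE /= (unsplitK (inl k)) (unsplitK (inr k)) /=.
rewrite !row_mxEl !row_mxEr.
by congr (0 < _); ring.
Qed.

(** Diagonal blocks split the form into a sum over [k] of 2 x 2 forms [q k] at [(x_k, y_k)]. All are
    nonnegative, and the sum vanishes only if every pair does. *)
Lemma diag_blocks_form_gt0 (R : realType) (n : nat) (A B C : 'M[R]_n) :
  is_diag_mx A -> is_diag_mx B -> is_diag_mx C ->
  (forall k, posdefmx (point_block (block_mx A B B C) k)) ->
  forall x y : 'cV[R]_n, (x != 0) || (y != 0) ->
  0 < bform A x x + 2 * bform B x y + bform C y y.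
Proof.
move=> dA dB dC pd x y xy.
rewrite !bform_diag // mulr_sumr -!big_split /=.
pose q k := x k 0 * A k k * x k 0 + 2 * (x k 0 * B k k * y k 0)
            + y k 0 * C k k * y k 0.
have q_gt0 k : (x k 0 != 0) || (y k 0 != 0) -> 0 < q k.
  exact: point_block_form.
have q0 k : 0 <= q k.
  have [/q_gt0/ltW//|] := boolP ((x k 0 != 0) || (y k 0 != 0)).
  rewrite negb_or !negbK => /andP[/eqP xk /eqP yk].
  by rewrite /q xk yk !mulr0 !addr0.
rewrite -[ltRHS]/(\sum_k q k) lt_def sumr_ge0 // andbT; apply: contraTneq xy => /eqP.
rewrite psumr_eq0 // => /allP h.
suff xy0 k : x k 0 = 0 /\ y k 0 = 0.
  rewrite negb_or !negbK; apply/andP; split; apply/eqP/colP => k;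
  by rewrite mxE; case: (xy0 k).
have /= qk := h k (mem_index_enum k).
suff : ~~ ((x k 0 != 0) || (y k 0 != 0)).
  by rewrite negb_or !negbK => /andP[/eqP ? /eqP ?].
by apply: contraTN qk => /q_gt0 /gt_eqF ->.
Qed.

(** Strictness comes from the null-spaces: a nonzero [(u, v)] is sent to a nonzero [(Q1 u, Q2 v)],
    where the form of the diagonal blocks is positive. *)
Lemma block_congr_posdef (R : realType) (n m1 m2 : nat) (D11 D12 D22 : 'M[R]_n)
    (B1 : 'M[R]_m1) (B2 : 'M[R]_m2) (Q1 : 'M[R]_(n, m1)) (Q2 : 'M[R]_(n, m2)) :
  B1^T = B1 -> B2^T = B2 ->
  is_diag_mx D11 -> is_diag_mx D12 -> is_diag_mx D22 ->
  trivial_nullspace Q1 -> trivial_nullspace Q2 ->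
  (forall u, bform D11 (Q1 *m u) (Q1 *m u) <= bform B1 u u) ->
  (forall v, bform D22 (Q2 *m v) (Q2 *m v) <= bform B2 v v) ->
  (forall k, posdefmx (point_block (block_mx D11 D12 D12 D22) k)) ->
  posdefmx (block_mx B1 (Q1^T *m D12 *m Q2) (Q2^T *m D12 *m Q1) B2).
Proof.
move=> sB1 sB2 d11 d12 d22 ker1 ker2 le1 le2 pd; split.
  by rewrite tr_block_mx sB1 sB2 !trmx_mul !trmxK !(diag_trmx d12) !mulmxA.
move=> z z0; rewrite -/(bform _ z z) -(vsubmxK z).
set u := usubmx z; set v := dsubmx z.
(* Since [D12] is symmetric, the two coupling terms are the same number, which gives the factor 2 of
   the pointwise form. *)
rewrite bform_block !bform_congr -(bform_trmx D12 (Q1 *m u)) (diag_trmx d12).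
have Quv : (Q1 *m u != 0) || (Q2 *m v != 0).
  apply: contraTT z0; rewrite negb_or !negbK => /andP[/eqP/ker1 u0 /eqP/ker2 v0].
  by rewrite -(vsubmxK z) -/u -/v u0 v0 col_mx0.
have := diag_blocks_form_gt0 d11 d12 d22 pd Quv.
rewrite -(bform_trmx D12 (Q1 *m u)) (diag_trmx d12).
by move: (le1 u) (le2 v); lra.
Qed.

Theorem mainTheorem4 (R : realType) (N : nat) (hN : (1 <= N)%N)
    (M : 'M[R]_(N.+1)) (Mh : 'M[R]_(N.+2))
    (P : 'M[R]_(N.+1, N.+2)) (Ph : 'M[R]_(N.+2, N.+1))
    (hM : is_diag_mx M /\ posdefmx M) (hMh : is_diag_mx Mh /\ posdefmx Mh)
    (hSBP : M *m P = Ph^T *m Mh)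
    (J1 g1_11 : 'M[R]_(N.+1 * N.+2))
    (J2 g2_22 : 'M[R]_(N.+2 * N.+1))
    (Jh gh11 gh22 gh12 : 'M[R]_(N.+2 * N.+2))
    (hJ1 : posdiagmx J1) (hg1 : posdiagmx g1_11)
    (hJ2 : posdiagmx J2) (hg2 : posdiagmx g2_22)
    (hJh : posdiagmx Jh) (hgh11 : posdiagmx gh11) (hgh22 : posdiagmx gh22)
    (hgh12 : is_diag_mx gh12) :
  let Ih : 'M[R]_(N.+2) := 1%:M in
  let H1 := M *t Mh in
  let H2 := Mh *t M in
  let Hh := Mh *t Mh in
  let P1c := P *t Ih in
  let Pc1 := Ph *t Ih in
  let P2c := Ih *t P in
  let Pc2 := Ih *t Ph in
  let G := block_mx g1_11 (invmx J1 *m P1c *m Jh *m gh12 *m Pc2)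
                    (invmx J2 *m P2c *m Jh *m gh12 *m Pc1) g2_22 in
  let H := block_mx H1 0 0 H2 in
  let J := block_mx J1 0 0 J2 in
  trivial_nullspace Pc1 -> trivial_nullspace Pc2 ->
  forall lmax1 lmax2 : R,
  max_gen_eigenvalue (Pc1^T *m Hh *m Jh *m gh11 *m Pc1) (H1 *m J1 *m g1_11)
    lmax1 ->
  max_gen_eigenvalue (Pc2^T *m Hh *m Jh *m gh22 *m Pc2) (H2 *m J2 *m g2_22)
    lmax2 ->
  forall alpha beta : R,
  0 < alpha <= 1 / lmax1 -> 0 < beta <= 1 / lmax2 ->
  let C := block_mx (alpha *: (Hh *m Jh *m gh11)) (Hh *m Jh *m gh12)
                    (Hh *m Jh *m gh12) (beta *: (Hh *m Jh *m gh22)) in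
  (forall k : 'I_(N.+2 * N.+2), posdefmx (point_block C k)) ->
  posdefmx (H *m J *m G).

Proof.
move=> Ih H1 H2 Hh P1c Pc1 P2c Pc2 G H J ker1 ker2 l1 l2 hl1 hl2 a b ha hb C pd.
have pM := posdef_posdiag hM.1 hM.2; have pMh := posdef_posdiag hMh.1 hMh.2.
have pH1 : posdiagmx H1 by exact: posdiag_tensmx.
have pH2 : posdiagmx H2 by exact: posdiag_tensmx.
have pHh : posdiagmx Hh by exact: posdiag_tensmx.
have pHJ : posdiagmx (Hh *m Jh) by exact: posdiag_mulmx.
have pB1 : posdiagmx (H1 *m J1 *m g1_11) by do 2!apply: posdiag_mulmx => //.
have pB2 : posdiagmx (H2 *m J2 *m g2_22) by do 2!apply: posdiag_mulmx => //.
have p11 : posdiagmx (Hh *m Jh *m gh11) by exact: posdiag_mulmx.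
have p22 : posdiagmx (Hh *m Jh *m gh22) by exact: posdiag_mulmx.
have d12 : is_diag_mx (Hh *m Jh *m gh12) by exact: is_diag_mulmx pHJ.1 hgh12.
(* The mixed-product rule reduces this to the one-dimensional SBP identity in one factor and to [Mh]
   times the identity in the other. *)
have sbp1 : H1 *m P1c = Pc1^T *m Hh.
  by rewrite /H1 /P1c /Pc1 /Hh trmx_tens !tensmx_mul hSBP trmx1 mul1mx mulmx1.
have sbp2 : H2 *m P2c = Pc2^T *m Hh.
  by rewrite /H2 /P2c /Pc2 /Hh trmx_tens !tensmx_mul hSBP trmx1 mul1mx mulmx1.
(* [J1] cancels its inverse, and SBP trades [H1 *m P1c] for [Pc1^T *m Hh], leaving a congruence of
   the off-diagonal block of [C]. *)
have E12 : H1 *m J1 *m (invmx J1 *m P1c *m Jh *m gh12 *m Pc2) =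
    Pc1^T *m (Hh *m Jh *m gh12) *m Pc2.
  rewrite !mulmxA -(mulmxA H1) mulmxV ?posdiag_unitmx // mulmx1.
  by rewrite sbp1.
have E21 : H2 *m J2 *m (invmx J2 *m P2c *m Jh *m gh12 *m Pc1) =
    Pc2^T *m (Hh *m Jh *m gh12) *m Pc1.
  rewrite !mulmxA -(mulmxA H2) mulmxV ?posdiag_unitmx // mulmx1.
  by rewrite sbp2.
have -> : H *m J *m G = block_mx (H1 *m J1 *m g1_11)
    (Pc1^T *m (Hh *m Jh *m gh12) *m Pc2) (Pc2^T *m (Hh *m Jh *m gh12) *m Pc1)
    (H2 *m J2 *m g2_22).
  rewrite /H /J /G !mulmx_block !(mul0mx, mulmx0, addr0, add0r).
  by rewrite E12 E21.
have diagZ c (D : 'M[R]_(N.+2 * N.+2)) : is_diag_mx D -> is_diag_mx (c *: D).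
  by move=> /diag_mxP [d ->]; rewrite -linearZ diag_mx_is_diag.
have congrE m (Q : 'M[R]_(N.+2 * N.+2, m)) g :
    Q^T *m Hh *m Jh *m g *m Q = Q^T *m (Hh *m Jh *m g) *m Q.
  by rewrite !mulmxA.
have congr_sym m (Q : 'M[R]_(N.+2 * N.+2, m)) D :
    is_diag_mx D -> (Q^T *m D *m Q)^T = Q^T *m D *m Q.
  by move=> dD; rewrite !trmx_mul trmxK (diag_trmx dD) mulmxA.
(* Regrouped, the left-hand matrices of both eigenproblems are congruences of the unscaled diagonal
   blocks of [C]. *)
rewrite !congrE in hl1 hl2.
apply: (@block_congr_posdef _ _ _ _ (a *: (Hh *m Jh *m gh11)) _
         (b *: (Hh *m Jh *m gh22))) => //.
- by rewrite (diag_trmx pB1.1).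
- by rewrite (diag_trmx pB2.1).
- exact: diagZ p11.1.
- exact: diagZ p22.1.
- move=> u; rewrite bformZl -bform_congr.
  exact: (scaled_rayleigh_bound (congr_sym _ _ _ p11.1) (posdiag_posdef pB1) hl1).
- move=> v; rewrite bformZl -bform_congr.
  exact: (scaled_rayleigh_bound (congr_sym _ _ _ p22.1) (posdiag_posdef pB2) hl2).
Qed.
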